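(* Run ARCNC over $\mathbb{F}_q$ on the $\binom{n}{m}$ combination network, which has $d=\binom nm$ sinks with first decoding times $T_r$, and let $T_{\mathrm{avg}}=\frac1d\sum_{r}T_r$. Put $$ET_{UB}(m,q)=\sum_{k=1}^m(-1)^{k-1}\binom mk\frac{1}{q^{k}-1},\qquad ET_{LB}(m,q)=\sum_{k=1}^m(-1)^{k-1}\binom mk\frac{1}{q^{km}-1}.$$ Then for each sink $r$, $E[T_{\mathrm{avg}}]=E[T_r]$ and $$ET_{LB}(m,q)\ <\ E[T_{\mathrm{avg}}]\ <\ ET_{UB}(m,q).$$ In particular, the upper bound $ET_{UB}(m,q)$ is a function of $m$ and $q$ only, independent of $n$ (for example, $ET_{UB}(2,2)=\frac53$); if $m$ is fixed and $n$ increases, $E[T_{\mathrm{avg}}]$ does not change; and $ET_{UB}(m,q)$ tends to $0$ as $q$ becomes large.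
   Context: The $\binom nm$ combination network has a single source $s$, $n$ intermediate nodes each joined to $s$ by one unit-capacity edge from $s$, and $d=\binom nm$ sinks, one for each $m$-element subset of the intermediate nodes; each sink receives one unit-capacity edge from each of the $m$ intermediate nodes of its subset. The source multicasts $m$ independent symbols of the finite field $\mathbb{F}_q$ per unit time, and the min-cut to each sink is $m$. In combination networks routing is insufficient and network coding is needed to achieve the multicast capacity $m$. Intermediate nodes only relay, so coding takes place only at the source. ARCNC (adaptive random convolutional network coding) on this network: for the edge from $s$ to intermediate node $v$, the global encoding kernel is a column vector $f_v(z)=\sum_{i\ge 0}f_{v,i}z^i$ with $f_{v,i}\in\mathbb{F}_q^m$; at each time $t=0,1,2,\dots$ the entries of $f_{v,t}$ are chosen uniformly at random from $\mathbb{F}_q$, independently of everything else, as long as some sink connected to $v$ has not yet achieved decodability, and are set to $0$ afterwards. At time $t$, sink $r$ has the $m\times m$ matrix $F_r(z)$ whose columns are the $m$ polynomial vectors $\sum_{i=0}^t f_{v,i}z^i$ of its parents $v$. The first decoding time $T_r$ is the smallest $t\ge0$ for which $F_r(z)$ at time $t$ has full rank $m$ (i.e. $\det F_r(z)$ is a non-zero polynomial).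
   Formalization: The strict bounds ET_LB < E[T_avg] < ET_UB are stated only for m ≥ 2, since for m = 1 all three quantities equal 1/(q−1) and the strict inequalities fail; every other claim is stated for all m ≥ 1. *)

(* Defs.v *)
From HB Require Import structures.
From mathcomp Require Export all_boot all_order all_algebra.
From mathcomp Require Export all_classical all_reals all_analysis.

Set Implicit Arguments.
Unset Strict Implicit.
Unset Printing Implicit Defensive.

Import Order.TTheory GRing.Theory Num.Theory.
Import numFieldNormedType.Exports.

Local Open Scope classical_set_scope.
Local Open Scope ring_scope.

(* The sinks of the combination network, each identified with the set of its
   [m] parents among the [n] intermediate nodes. *)
Definition sink (n m : nat) := {r : {set 'I_n} | #|r| == m}.

Definition parent (n m : nat) (r : sink n m) (j : 'I_m) : 'I_n :=
  enum_val (cast_ord (esym (eqP (valP r))) j).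

Section Code.
Variables (n m : nat) (F : finFieldType).

(* [f t v] is the coefficient of [z^t] in the global encoding kernel of the
   edge from the source to the intermediate node [v]. *)
Definition kernels := nat -> 'I_n -> 'cV[F]_m.

Definition transfer (f : kernels) (r : sink n m) (t : nat) : 'M[{poly F}]_m :=
  \matrix_(i < m, j < m) \poly_(k < t.+1) f k (parent r j) i 0.

Definition decodable (f : kernels) (r : sink n m) (t : nat) : bool :=
  \det (transfer f r t) != 0.

(* Stated over all [s < t] since a nonzero determinant may vanish again when
   terms of higher degree are added: only the first success counts. *)
Definition undecoded_before (f : kernels) (r : sink n m) (t : nat) : bool :=
  [forall s : 'I_t, ~~ decodable f r s].

Definition active (f : kernels) (v : 'I_n) (t : nat) : bool :=
  [exists r : sink n m, (v \in val r) && undecoded_before f r t].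

(* [arcnc x] is the run in which [x t v] is the value drawn for node [v] at
   time [t]: the draw is used while [v] is active and replaced by 0 afterwards,
   see [arcncE]. [arcnc_upto x t] holds the coefficients of the times [< t]. *)
Fixpoint arcnc_upto (x : kernels) (t : nat) : kernels :=
  if t is t'.+1 then
    let f := arcnc_upto x t' in
    fun s v => if s == t' then (if active f v t' then x t' v else 0) else f s v
  else fun _ _ => 0.

Definition arcnc (x : kernels) : kernels := fun t v => arcnc_upto x t.+1 t v.

Lemma eq_active (f g : kernels) (v : 'I_n) (t : nat) :
  (forall s, (s < t)%N -> f s = g s) -> active f v t = active g v t.
Proof.
move=> fg; apply: eq_existsb => r; congr (_ && _).
apply: eq_forallb => s; congr (~~ (\det _ != 0)).
apply/matrixP => i j; rewrite !mxE; apply/polyP => k; rewrite !coef_poly.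
case: ifP => // ks; rewrite fg //.
by rewrite (leq_trans ks) // ltn_ord.
Qed.

Lemma arcncE (x : kernels) (t : nat) (v : 'I_n) :
  arcnc x t v = if active (arcnc x) v t then x t v else 0.
Proof.
have uptoE u s : (s < u)%N -> arcnc_upto x u s = arcnc x s.
  elim: u => // u IH; rewrite ltnS leq_eqVlt => /orP[/eqP-> //|su].
  by rewrite -IH //; apply/funext => w /=; rewrite ltn_eqF.
rewrite {1}/arcnc /= eqxx (@eq_active _ (arcnc x)) // => s st.
exact: uptoE.
Qed.

End Code.

(* [+oo] on the event (of probability 0) that the sink never decodes. *)
Definition first_decoding_time (R : realType) (n m : nat) (F : finFieldType)
    (f : kernels n m F) (r : sink n m) : \bar R :=
  if pselect (exists t, decodable f r t) is left h then (ex_minn h)%:R%:E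
  else +oo%E.

Section Random.
Variables (R : realType) (d : measure_display) (Omega : measurableType d).
Variable P : probability Omega R.

Definition mutually_independent (I : eqType) (V : Type)
    (X : I -> Omega -> V) : Prop :=
  forall (s : seq I) (B : I -> set V), uniq s ->
    P (\bigcap_(i in [set` s]) (X i @^-1` B i)) =
    (\prod_(i <- s) P (X i @^-1` B i))%E.

(* The values lie in a finite set, endowed with its discrete sigma-algebra. *)
Definition iid_uniform (I : eqType) (V : finType) (X : I -> Omega -> V)
  : Prop :=
  [/\ forall i (B : set V), measurable (X i @^-1` B),
      forall i a, P (X i @^-1` [set a]) = ((#|V|%:R)^-1)%:E
    & mutually_independent X].

Variables (n m : nat) (F : finFieldType).

(* [X (t, v, i)] is the [i]-th entry of the vector drawn at time [t] for the
   intermediate node [v]. *)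
Variable X : (nat * 'I_n * 'I_m)%type -> Omega -> F.

Definition draws (w : Omega) : kernels n m F :=
  fun t v => \col_(i < m) X (t, v, i) w.

Definition T_sink (r : sink n m) (w : Omega) : \bar R :=
  first_decoding_time R (arcnc (draws w)) r.

Definition T_avg (w : Omega) : \bar R :=
  (('C(n, m)%:R^-1)%:E * \sum_(r : sink n m) T_sink r w)%E.

(* The library's expectation is for real-valued functions; the decoding times
   take values in [\bar R]. *)
Definition expect (T : Omega -> \bar R) : \bar R := (\int[P]_w T w)%E.

End Random.

Definition ET_UB (R : realType) (m q : nat) : R :=
  \sum_(1 <= k < m.+1)
    (-1) ^+ (k - 1)%N * 'C(m, k)%:R * (q%:R ^+ k - 1)^-1.

Definition ET_LB (R : realType) (m q : nat) : R :=
  \sum_(1 <= k < m.+1)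
    (-1) ^+ (k - 1)%N * 'C(m, k)%:R * (q%:R ^+ (k * m)%N - 1)^-1.

(* Main.v *)
(* Write q = #|F|. A sink that has not decoded keeps its parents active, so
   its decoding time is that of the raw draws, and the event T_r > t only
   depends on the uniform m x m matrix A_t of polynomials of degree at most t
   formed by its parents' draws; hence E[T_r] = sum_t P(T_r > t) depends on m
   and q only.

   With Q = q^(t+1), the event T_r > t contains the event that some column of
   A_t is 0, of probability 1 - (1 - Q^-m)^m, and is contained in
   det A_t = 0, of probability at most 1 - (1 - 1/Q)^m: when the lower right
   minor of a matrix is nonzero, at most one value of the top left entry makes
   the determinant vanish. Both comparisons are strict for m > 1. By the
   binomial formula and geometric series, the sums over t of these bounds are
   ET_LB and ET_UB. *)
Require Import Defs.
From HB Require Import structures.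
From mathcomp Require Import all_boot all_order all_algebra.
From mathcomp Require Import all_classical all_reals all_analysis.
From mathcomp Require Import measurable_realfun.
From mathcomp Require Import perm ring zify.

Set Implicit Arguments.
Unset Strict Implicit.
Unset Printing Implicit Defensive.

Import Order.TTheory GRing.Theory Num.Theory.
Import numFieldNormedType.Exports.

Local Open Scope classical_set_scope.
Local Open Scope ring_scope.

(** * Counting nonsingular matrices with entries in a finite subset of a domain *)

Section NonsingularCount.
Variables (D : idomainType) (T : finType) (e : T -> D).
Hypothesis e_inj : injective e.

(** Entries come from a finite type [T] embedded in [D] by [e], so that matrices can be counted;
    later [T] holds coefficient vectors and [D] is a polynomial ring. *)
Definition nonsingular m : pred 'M[T]_m := fun A => \det (map_mx e A) != 0.
Arguments nonsingular m A : clear implicits.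

(** By linearity in the first row, the determinant is affine in the top left entry, with the
    complementary minor as slope. *)
Lemma det_block_mx_diff m (x y : D) (l : 'rV[D]_m) (c : 'cV[D]_m) B :
  \det (block_mx x%:M l c B) - \det (block_mx y%:M l c B) = (x - y) * \det B.
Proof.
suff -> : \det (block_mx x%:M l c B) =
    1 * \det (block_mx y%:M l c B) + 1 * \det (block_mx (x - y)%:M 0 c B).
  by rewrite det_lblock det_scalar1; ring.
have row'E (z : D) (l' : 'rV[D]_m) :
    row' (lshift m 0) (block_mx z%:M l' c B) = row_mx c B.
  rewrite /block_mx row'Ku; apply/matrixP => i j; rewrite mxE.
  by case: splitP => [[]//|k ik]; congr (row_mx c B _ j); apply: val_inj.
apply: (@determinant_multilinear _ _ _ _ _ (lshift m 0)); rewrite ?row'E //.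
rewrite !rowKu !scale1r !row_row_mx add_row_mx raddf0 addr0 -linearD /=.
by rewrite -raddfD /= addrC subrK.
Qed.

(** Over a nonsingular minor, the bordering row and column are free, with [#|T| ^ m] choices each,
    and at most one top left entry is bad. *)
Lemma leq_nonsingular_minor m :
  (#|nonsingular m| * (#|T| ^ m * #|T| ^ m) * (#|T| - 1) <=
   #|[pred A : 'M[T]_(1 + m) | nonsingular m (drsubmx A)
                               && nonsingular (1 + m) A]|)%N.
Proof.
set P := [pred A | _].
pose h (p : 'M[T]_m * ('rV[T]_m * 'cV[T]_m) * T) : 'M[T]_(1 + m) :=
  block_mx (const_mx p.2) p.1.2.1 p.1.2.2 p.1.1.
have h_bij : bijective h.
  exists (fun A => ((drsubmx A, (ursubmx A, dlsubmx A)), ulsubmx A 0 0)).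
    by case=> -[B [l c]] x; rewrite /h /= block_mxKdr block_mxKur block_mxKdl
      block_mxKul mxE.
  move=> A; rewrite /h /= -[RHS]submxK; congr block_mx.
  by apply/matrixP => i j; rewrite mxE !ord1.
rewrite -[leqRHS]sum1_card (reindex h) /=; last exact: onW_bij.
under eq_bigl do rewrite /P inE /= /h block_mxKdr.
rewrite -(@pair_big_dep _ _ _ _ _ (fun w => nonsingular m w.1)
  (fun w x => nonsingular (1 + m) (h (w, x))) (fun _ _ => 1%N)) /=.
have -> : (#|nonsingular m| * (#|T| ^ m * #|T| ^ m))%N =
    #|[pred w : 'M[T]_m * ('rV[T]_m * 'cV[T]_m) | nonsingular m w.1]|.
  have := cardX (nonsingular m) [pred x : 'rV[T]_m * 'cV[T]_m | true].
  rewrite card_prod !card_mx mul1n muln1 => <-.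
  by apply: eq_card => w; rewrite !inE andbT.
rewrite -sum_nat_const; apply: leq_sum => -[B [l c]] /= B_ns.
rewrite sum1_card -(cardC (fun x => nonsingular (1 + m) (h (B, (l, c), x)))).
rewrite leq_subLR [leqRHS]addnC leq_add2l; apply/card_le1_eqP => x y.
rewrite !inE !negbK /nonsingular /h /= !map_block_mx !map_const_mx.
have const1 (z : D) : const_mx z = z%:M :> 'M[D]_1.
  by apply/matrixP => i j; rewrite !mxE !ord1 eqxx.
rewrite !const1 => /eqP dx /eqP dy; apply: e_inj; apply/eqP.
rewrite -subr_eq0.
have := det_block_mx_diff (e y) (e x) (map_mx e l) (map_mx e c) (map_mx e B).
by rewrite dx dy subrr => /esym/eqP; rewrite mulf_eq0 (negbTE B_ns) orbF.
Qed.

(** Induction by bordering: each of the [m] diagonal entries keeps at least [#|T| - 1] good values,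
    and the [m * m - m] other entries are free. *)
Lemma leq_nonsingular m :
  ((#|T| - 1) ^ m * #|T| ^ (m * m - m) <= #|nonsingular m|)%N.
Proof.
elim: m => [|m IH].
  rewrite (@eq_card _ (nonsingular 0) predT).
    by rewrite card_mx mul0n subn0 !expn0.
  move=> A.
  by rewrite -[LHS]/(nonsingular 0 A) /nonsingular det_mx00 oner_eq0.
have leP := leq_nonsingular_minor m; set P := [pred A | _] in leP.
have {leP} := leq_trans leP (@subset_leq_card _ P (nonsingular m.+1) _).
have PS : P \subset nonsingular m.+1.
  by apply/fintype.subsetP => A; rewrite inE => /andP[_ A_ns]; exact: A_ns.
move=> /(_ PS); apply: leq_trans.
have -> : (m.+1 * m.+1 - m.+1 = (m * m - m) + (m + m))%N by nia.
rewrite expnS !expnD; nia.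
Qed.

(** The last bordering step loses the nonsingular matrices with singular minor; [z] and [u] stand
    for 0 and 1, the entries of such a matrix. *)
Lemma ltn_nonsingular m z u : e z = 0 -> e u = 1 -> (1 < m)%N ->
  ((#|T| - 1) ^ m * #|T| ^ (m * m - m) < #|nonsingular m|)%N.
Proof.
case: m => [|[|m]]// ez eu _.
have := leq_nonsingular_minor m.+1.
have := leq_nonsingular m.+1.
set P := [pred A | _]; set N := #|nonsingular m.+1|.
move=> leN leP.
have : (#|P| < #|nonsingular m.+2|)%N.
  apply: proper_card; apply/properP; split.
    by apply/fintype.subsetP => A; rewrite inE => /andP[_ A_ns]; exact: A_ns.
  (* Strictness: a transposition matrix is invertible, its minor is not. *)
  pose s : 'S_(m.+2) := tperm 0 1.
  exists (\matrix_(i, j) if s i == j then u else z).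
    rewrite -topredE /= /nonsingular.
    have -> : map_mx e (\matrix_(i, j) if s i == j then u else z) = perm_mx s.
      by apply/matrixP => i j; rewrite !mxE; case: ifP => _ /=.
    by rewrite det_perm; case: (odd_perm _); rewrite ?expr1 ?oppr_eq0 oner_eq0.
  rewrite inE negb_and; apply/orP; left; rewrite negbK.
  (* The first row of the minor comes from row 1 of the matrix, whose only nonzero entry lies in the
     removed column 0. *)
  apply/det0P; exists (delta_mx 0 0).
    by apply/eqP => /matrixP/(_ 0 0)/eqP; rewrite !mxE eqxx oner_eq0.
  rewrite -rowE; apply/rowP => j; rewrite !mxE.
  have -> : s (rshift 1 0) = 0.
    by rewrite -[RHS](tpermR 0 1); congr (s _); apply: val_inj.
  by rewrite (_ : 0 == rshift 1 j = false).
apply: leq_ltn_trans; apply: leq_trans leP.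
have -> : (m.+2 * m.+2 - m.+2 = (m.+1 * m.+1 - m.+1) + (m.+1 + m.+1))%N by nia.
rewrite expnS !expnD; nia.
Qed.
End NonsingularCount.

(** * Two-sided count of the samples on which a sink has not decoded *)

Section Stuck.
Variables (F : finFieldType) (m t : nat).
Let T : finType := 'rV[F]_t.+1.

(* An entry of ['M[T]_m] lists the coefficients of degree [0] to [t] of an
   entry of the transfer matrix: this is the finite sample space of a sink. *)
Definition stuck : pred 'M[T]_m := fun A =>
  [forall s : 'I_t.+1,
    \det (map_mx (fun v : 'rV[F]_t.+1 => take_poly s.+1 (rVpoly v)) A) == 0].

Lemma stuck_nonsingular A :
  stuck A -> ~~ nonsingular (fun v : T => rVpoly v) A.
Proof.
(* At the last index, truncation to [t.+1] coefficients keeps the whole polynomial. *)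
move=> /forallP/(_ ord_max) /eqP detA; rewrite negbK -detA.
apply/eqP; congr (\det _); apply/matrixP => i j; rewrite !mxE.
by rewrite take_poly_id // size_poly.
Qed.

Lemma ltn_card_stuck : (1 < m)%N ->
  (#|stuck| + (#|T| - 1) ^ m * #|T| ^ (m * m - m) < #|T| ^ (m * m))%N.
Proof.
move=> m1; pose e (v : T) : {poly F} := rVpoly v.
have e_inj : injective e := can_inj (@rVpolyK F t.+1).
have e0 : e 0 = 0 by exact: raddf0.
have e1 : e (poly_rV 1) = 1 by rewrite /e poly_rV_K // size_poly1.
have := ltn_nonsingular e_inj e0 e1 m1.
rewrite -card_mx -(cardC (nonsingular e (m := m))) -(ltn_add2l #|stuck|).
move=> /leq_trans; apply; rewrite addnC leq_add2l; apply: subset_leq_card.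
by apply/fintype.subsetP => A /stuck_nonsingular.
Qed.

(** A matrix is determined by its columns, so these matrices inject into the functions from column
    indices to nonzero vectors. *)
Lemma card_nonzero_cols (U : finZmodType) n p :
  (#|[pred A : 'M[U]_(p, n) | [forall j, col j A != 0%R]]|
   <= (#|U| ^ p - 1) ^ n)%N.
Proof.
have -> : (#|U| ^ p - 1 = #|predC1 (0%R : 'cV[U]_p)|)%N.
  by rewrite cardC1 card_mx muln1 subn1.
rewrite -[n in leqRHS]card_ord -card_ffun_on.
pose h (A : 'M[U]_(p, n)) := [ffun j => col j A].
have h_inj : injective h.
  move=> A B /ffunP hAB; apply/matrixP => i j.
  by have := hAB j; rewrite !ffunE => /colP/(_ i); rewrite !mxE.
rewrite -(fintype.card_image h_inj); apply: subset_leq_card.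
apply/fintype.subsetP => f; move=> /fintype.imageP[A /forallP Acol ->].
by apply/ffun_onP => j; rewrite ffunE inE Acol.
Qed.

(** A zero column stays zero under every truncation, so every matrix outside [P] is stuck. *)
Lemma gtn_card_stuck : (1 < m)%N ->
  (#|T| ^ (m * m) < #|stuck| + (#|T| ^ m - 1) ^ m)%N.
Proof.
move=> m1; set P := [pred A : 'M['rV[F]_t.+1]_m | [forall j, col j A != 0%R]].
have leP := card_nonzero_cols 'rV[F]_t.+1 m m.
rewrite -/P in leP.
apply: leq_trans (leq_add (leqnn _) leP).
rewrite -card_mx -(cardC P) addnC ltn_add2r; apply: proper_card.
apply/properP; split.
  apply/fintype.subsetP => A; rewrite !inE negb_forall.
  move=> /existsP[j /negPn/eqP Aj].
  apply/forallP => s; rewrite -det_tr; apply/det0P; exists (delta_mx 0 j).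
    by apply/eqP => /matrixP/(_ 0 j)/eqP; rewrite !mxE !eqxx oner_eq0.
  rewrite -rowE; apply/rowP => i; rewrite !mxE.
  by move/colP : Aj => /(_ i); rewrite !mxE => ->; rewrite raddf0 take_poly0r.
(* Strictness: with all entries equal and nonzero, no column vanishes, yet two rows agree at every
   truncation. *)
exists (const_mx (const_mx 1)); last first.
  rewrite inE negbK; apply/forallP => j; apply/eqP => /colP/(_ j).
  by rewrite !mxE => /rowP/(_ 0)/eqP; rewrite !mxE oner_eq0.
apply/forallP => s; apply/det0P.
pose i0 := Ordinal (ltnW m1); pose i1 := Ordinal m1.
exists (delta_mx 0 i0 - delta_mx 0 i1).
  apply/eqP => /matrixP/(_ 0 i0)/eqP.
  by rewrite !mxE !eqxx subr0 oner_eq0.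
by rewrite mulmxBl -!rowE; apply/rowP => i; rewrite !mxE subrr.
Qed.

End Stuck.

(** * Geometric series, strict comparison of series, and the limit in [q] *)

Section Series.
Variable R : realType.

(** The limit [x / (1 - x)] is written so that [x = q^-k] yields the term [1 / (q^k - 1)]. *)
Lemma geometric_series_succ (x : R) : 0 < x < 1 ->
  series (fun t => x ^+ t.+1) @ \oo --> (x^-1 - 1)^-1.
Proof.
move=> /andP[x0 x1].
have -> : (x^-1 - 1)^-1 = x / (1 - x).
  have x_neq0 : x != 0 by rewrite gt_eqF.
  have x_neq1 : 1 - x != 0 by rewrite subr_eq0 gt_eqF.
  by field; rewrite x_neq1 x_neq0.
rewrite (_ : (fun t => _) = geometric x x).
  by apply: cvg_geometric_series; rewrite gtr0_norm.
by apply/funext => t; rewrite /geometric /= exprS.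
Qed.

Lemma one_minus_expB (m : nat) (y : R) :
  1 - (1 - y) ^+ m =
  \sum_(1 <= k < m.+1) (-1) ^+ (k - 1)%N * 'C(m, k)%:R * y ^+ k.
Proof.
rewrite exprBn big_ord_recl /= !expr0 expr1n !mulr1 bin0 mulr1n opprD addrA.
rewrite subrr add0r -sumrN big_add1 /= big_mkord; apply: eq_bigr => i _.
rewrite /= /bump add1n subn1 /= exprS !mulN1r expr1n mulr1 mulNr mulNrn opprK.
by rewrite mulrAC mulr_natr.
Qed.

(** After binomial expansion, the [k]-th term sums to a geometric series of ratio [x ^+ k]. Taking
    [x = 1/q] gives [ET_UB], and [x = q^-m] gives [ET_LB]. *)
Lemma nneseries_one_minus_expB (m : nat) (x : R) : 0 < x < 1 ->
  (\sum_(0 <= t <oo) (1 - (1 - x ^+ t.+1) ^+ m)%:E =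
   (\sum_(1 <= k < m.+1)
      (-1) ^+ (k - 1)%N * 'C(m, k)%:R * ((x^-1) ^+ k - 1)^-1)%:E)%E.
Proof.
move=> /andP[x0 x1].
have cvgS : series (fun t => 1 - (1 - x ^+ t.+1) ^+ m) @ \oo -->
    \sum_(1 <= k < m.+1)
      (-1) ^+ (k - 1)%N * 'C(m, k)%:R * ((x^-1) ^+ k - 1)^-1.
  have -> : series (fun t => 1 - (1 - x ^+ t.+1) ^+ m) = fun N =>
      \sum_(1 <= k < m.+1) (-1) ^+ (k - 1)%N * 'C(m, k)%:R *
        series (fun t => (x ^+ k) ^+ t.+1) N.
    apply/funext => N; rewrite /series /=.
    under eq_bigr do rewrite one_minus_expB.
    rewrite exchange_big /=; apply: eq_bigr => k _; rewrite mulr_sumr.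
    by apply: eq_bigr => t _; rewrite -!exprM mulnC.
  rewrite big_add1 /=; under eq_cvg do rewrite big_add1 /=.
  apply: cvg_big => [|k _]; first exact: add_continuous.
  apply: cvgMl_tmp; rewrite exprVn; apply: geometric_series_succ.
  by rewrite exprn_gt0 //= exprn_ilt1 // ltW.
rewrite -(cvg_lim _ cvgS)// -EFin_lim; last first.
  by apply/cvg_ex; eexists; exact: cvgS.
by congr (limn _); apply/funext => N; rewrite /= sumEFin.
Qed.

(** Strictness comes from the terms at 0, split off from weakly compared tails; a finite tail of [u]
    keeps it under addition. *)
Lemma lt_nneseries (u v : nat -> R) :
  (forall t, 0 <= u t) -> (forall t, u t < v t) ->
  (\sum_(0 <= t <oo) (u t)%:E < +oo)%E ->
  (\sum_(0 <= t <oo) (u t)%:E < \sum_(0 <= t <oo) (v t)%:E)%E.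
Proof.
move=> u0 uv ufin.
have v0 t : 0 <= v t by rewrite (le_trans (u0 t)) // ltW.
have recl (w : nat -> R) : (forall t, 0 <= w t) ->
    (\sum_(0 <= t <oo) (w t)%:E =
     (w 0%N)%:E + \sum_(1 <= t <oo) (w t)%:E)%E.
  by move=> w0; rewrite nneseries_recl // => k _; rewrite lee_fin.
move: ufin; rewrite !recl //.
set A := (\sum_(1 <= k <oo) (u k)%:E)%E => ufin.
apply: lte_leD; rewrite ?lte_fin //.
  have A0 : (0 <= A)%E by apply: nneseries_ge0 => *; rewrite lee_fin.
  by rewrite ge0_fin_numE //; apply: le_lt_trans ufin; rewrite leeDr ?lee_fin.
by apply: lee_nneseries => k *; rewrite lee_fin // ltW.
Qed.

Lemma cvg_ET_UB (m : nat) : ET_UB R m q @[q --> \oo] --> (0 : R).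
Proof.
(* From [q = 2] on, every denominator is positive; at [q = n + 2] it is at least [n + 1], so each
   inverse is squeezed below the harmonic sequence. *)
rewrite -(cvg_shiftn 2) /=.
(* The limit 0 is given the shape of the sum so that limits can be taken term by term. *)
pose s0 : R := \sum_(1 <= k < m.+1) (-1) ^+ (k - 1)%N * 'C(m, k)%:R * 0.
have s0E : s0 = 0 by apply: big1 => k _; rewrite mulr0.
suff : ET_UB R m (n + 2)%N @[n --> \oo] --> s0 by rewrite s0E.
rewrite /ET_UB /s0 big_add1 /=; under eq_cvg do rewrite big_add1 /=.
apply: cvg_big => [|k _]; first exact: add_continuous.
apply: cvgMl_tmp; apply: squeeze_cvgr (cvg_cst 0) cvg_harmonic.
apply: nearW => n /=.
have le_exp : n.+1%:R <= (n + 2)%:R ^+ k.+1 - 1 :> R.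
  rewrite lerBrDr natr1 -natrX ler_nat addn2.
  by rewrite expnS leq_pmulr // expn_gt0.
have exp_gt0 : 0 < (n + 2)%:R ^+ k.+1 - 1 :> R by exact: lt_le_trans le_exp.
by rewrite invr_ge0 ltW //= lef_pV2 // posrE.
Qed.

End Series.

(** * From counts to probabilities and their sums *)

Section StuckProbability.
Variables (R : realType) (F : finFieldType) (m : nat).

(** A sample consists of [t.+1] field elements for each of the [m * m] matrix entries. *)
Definition stuck_prob (t : nat) : R :=
  #|@stuck F m t|%:R / #|F|%:R ^+ (t.+1 * (m * m))%N.

Lemma card_field_gt1 : 1 < #|F|%:R :> R.
Proof. by rewrite ltr1n card_finNzRing_gt1. Qed.

Lemma stuck_prob_ge0 t : 0 <= stuck_prob t.
Proof. by rewrite divr_ge0 // exprn_ge0. Qed.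

Lemma stuck_prob_lt t : (1 < m)%N ->
  stuck_prob t < 1 - (1 - (#|F|%:R^-1) ^+ t.+1) ^+ m.
Proof.
move=> /(@ltn_card_stuck F m t); rewrite card_mx mul1n.
rewrite /stuck_prob exprM exprVn.
have F0 : (0 < #|F| ^ t.+1)%N by rewrite expn_gt0 (ltnW (card_finNzRing_gt1 F)).
rewrite -natrX; move: (#|F| ^ t.+1)%N F0 => Q Q0 ltQ.
have Q0R : 0 < Q%:R :> R by rewrite ltr0n.
rewrite ltr_pdivrMr ?exprn_gt0 // mulrBl mul1r ltrBrDr.
have mm : (m <= m * m)%N by nia.
have -> : (1 - (Q%:R)^-1) ^+ m * Q%:R ^+ (m * m)%N =
    ((Q - 1) ^ m * Q ^ (m * m - m))%N%:R :> R.
  rewrite -[in LHS](subnKC mm) exprD mulrA -exprMn mulrBl mul1r.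
  by rewrite mulVf ?gt_eqF // natrM !natrX natrB.
by rewrite -natrX -natrD ltr_nat.
Qed.

Lemma stuck_prob_gt t : (1 < m)%N ->
  1 - (1 - (#|F|%:R ^- m) ^+ t.+1) ^+ m < stuck_prob t.
Proof.
move=> /(@gtn_card_stuck F m t); rewrite card_mx mul1n.
rewrite /stuck_prob exprM exprVn exprAC.
have F0 : (0 < #|F| ^ t.+1)%N by rewrite expn_gt0 (ltnW (card_finNzRing_gt1 F)).
rewrite -natrX; move: (#|F| ^ t.+1)%N F0 => Q Q0 ltQ.
have Q0R : 0 < Q%:R :> R by rewrite ltr0n.
rewrite ltr_pdivlMr ?exprn_gt0 // mulrBl mul1r ltrBlDr.
have -> : (1 - (Q%:R ^+ m)^-1) ^+ m * Q%:R ^+ (m * m)%N =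
    ((Q ^ m - 1) ^ m)%N%:R :> R.
  rewrite exprM -exprMn mulrBl mul1r mulVf ?gt_eqF ?exprn_gt0 //.
  by rewrite natrX natrB ?natrX // expn_gt0 Q0.
by rewrite -natrX -natrD ltr_nat.
Qed.

(** At [m = 1] both bounds equal [1 / (q - 1)], hence the condition [1 < m]. *)
Lemma sum_stuck_prob_bounds : (1 < m)%N ->
  ((ET_LB R m #|F|)%:E < \sum_(0 <= t <oo) (stuck_prob t)%:E)%E /\
  (\sum_(0 <= t <oo) (stuck_prob t)%:E < (ET_UB R m #|F|)%:E)%E.
Proof.
move=> m1; have q1 := card_field_gt1.
have q0 : 0 < #|F|%:R :> R by exact: lt_trans q1.
have x01 : 0 < (#|F|%:R : R)^-1 < 1 by rewrite invr_gt0 q0 invf_lt1.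
have y01 : 0 < (#|F|%:R : R) ^- m < 1.
  by rewrite invr_gt0 exprn_gt0 //= invf_lt1 ?exprn_gt0 //
    exprn_egt1 // -lt0n ltnW.
have LBE : ET_LB R m #|F| = \sum_(1 <= k < m.+1)
    (-1) ^+ (k - 1)%N * 'C(m, k)%:R * (((#|F|%:R : R) ^- m)^-1 ^+ k - 1)^-1.
  by apply: eq_bigr => k _; rewrite invrK -exprM mulnC.
have UBE : ET_UB R m #|F| = \sum_(1 <= k < m.+1)
    (-1) ^+ (k - 1)%N * 'C(m, k)%:R * (((#|F|%:R : R)^-1)^-1 ^+ k - 1)^-1.
  by apply: eq_bigr => k _; rewrite invrK.
rewrite UBE LBE -!nneseries_one_minus_expB //; split.
  apply: lt_nneseries => [t|t|].
  - have /andP[/ltW y0 /ltW y1] := y01.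
    by rewrite subr_ge0 exprn_ile1 ?subr_ge0 ?exprn_ile1 // gerBl exprn_ge0.
  - exact: stuck_prob_gt.
  - by rewrite nneseries_one_minus_expB // ltry.
have cmp t : stuck_prob t < 1 - (1 - (#|F|%:R^-1) ^+ t.+1) ^+ m.
  exact: stuck_prob_lt.
apply: lt_nneseries => //; first exact: stuck_prob_ge0.
(* The finiteness demanded by the strict comparison comes from the dominating series, whose sum is
   known. *)
apply: (@le_lt_trans _ _
  (\sum_(0 <= t <oo) (1 - (1 - (#|F|%:R^-1 : R) ^+ t.+1) ^+ m)%:E)%E).
  by apply: lee_nneseries => t *; rewrite lee_fin ?stuck_prob_ge0 // ltW.
by rewrite nneseries_one_minus_expB // ltry.
Qed.

End StuckProbability.

(** * Uniform law of finitely many coordinates of an i.i.d. family *)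

Section FiniteEvents.
Variables (R : realType) (d : measure_display) (Omega : measurableType d).
Variables (P : probability Omega R) (I : eqType) (V : finType).
Variables (X : I -> Omega -> V) (J W : finType) (phi : J -> I).
Variables (c : W -> J -> V) (Y : Omega -> W).
Hypotheses (iidX : iid_uniform P X) (phi_inj : injective phi).
(** [Y] packages the coordinates [X (phi j)] into one finite value, and [c] reads them back. *)
Hypothesis Y_coord :
  forall w a, Y w = a <-> forall j, X (phi j) w = c a j.

(** Independence concerns events indexed by [I], so the constraint at [j] is carried over to the
    index [phi j]. *)
Lemma preimage_coordE (a : W) :
  Y @^-1` [set a] =
  \bigcap_(i in [set` map phi (enum J)])
    (X i @^-1` [set v | forall j, phi j = i -> v = c a j]).
Proof.
apply/seteqP; split => w /=.
  by move=> /Y_coord Xw i _ j <-.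
move=> Xw; apply/Y_coord => j.
by apply: (Xw (phi j)) => //=; rewrite map_f ?mem_enum.
Qed.

Lemma measurable_coord (a : W) : measurable (Y @^-1` [set a]).
Proof.
rewrite preimage_coordE; apply: fin_bigcap_measurable.
  exact: finite_seq.
by move=> i _; case: iidX.
Qed.

Lemma prob_coord (a : W) :
  P (Y @^-1` [set a]) = (#|V|%:R ^- #|J|)%:E.
Proof.
have [_ unif indep] := iidX.
rewrite preimage_coordE indep; last by rewrite map_inj_uniq ?enum_uniq.
rewrite big_map.
rewrite (eq_bigr (fun=> (#|V|%:R^-1 : R)%:E)) => [|j _].
  by rewrite prodEFin big_const_seq count_predT -cardE iter_mulr_1 exprVn.
(* Injectivity of [phi] leaves a single constraint at this index, so the set is a singleton. *)
rewrite -(unif (phi j) (c a j)); congr (P (_ @^-1` _)).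
apply/seteqP; split => v /=; first exact.
by move=> -> j' /phi_inj ->.
Qed.

Lemma event_bigcup (B : pred W) :
  [set w | B (Y w)] = \bigcup_(a in [set` enum B]) Y @^-1` [set a].
Proof.
apply/seteqP; split => w /=; first by exists (Y w) => //=; rewrite mem_enum.
by move=> [a /=]; rewrite mem_enum => Ba ->.
Qed.

Lemma measurable_event (B : pred W) : measurable [set w | B (Y w)].
Proof.
rewrite event_bigcup; apply: fin_bigcup_measurable; first exact: finite_seq.
by move=> a _; exact: measurable_coord.
Qed.

Lemma prob_event (B : pred W) :
  P [set w | B (Y w)] = (#|B|%:R / #|V|%:R ^+ #|J|)%:E.
Proof.
rewrite event_bigcup (measure_fin_bigcup P (finite_seq (enum B))); last first.
- by move=> a _; exact: measurable_coord.
- by move=> a b _ _ [w [/= <- <-]].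
rewrite -fsbig_seq ?enum_uniq //.
rewrite (eq_bigr (fun=> (#|V|%:R ^- #|J| : R)%:E)) => [|a _].
  rewrite sumEFin big_const_seq count_predT -cardE iter_addr_0.
  by rewrite -[_ *+ #|B|]mulr_natl.
exact: prob_coord.
Qed.

End FiniteEvents.

(** * Reduction of a run to the raw draws, and the tail-sum form of the decoding time *)

Lemma parent_inj n m (r : sink n m) : injective (parent r).
Proof. by move=> i j /enum_val_inj/cast_ord_inj. Qed.

Lemma parent_in n m (r : sink n m) j : parent r j \in val r.
Proof. exact: enum_valP. Qed.

Section RunOfArcnc.
Variables (n m : nat) (F : finFieldType).
Implicit Types (f x : kernels n m F) (r : sink n m).

Lemma eq_decodable f g r t :
  (forall s v, (s <= t)%N -> v \in val r -> f s v = g s v) ->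
  decodable f r t = decodable g r t.
Proof.
move=> fg; congr (\det _ != 0); apply/matrixP => i j; rewrite !mxE.
apply/polyP => k; rewrite !coef_poly; case: ifP => // kt.
by rewrite fg ?parent_in.
Qed.

Lemma undecoded_beforeP f r t :
  reflect (forall s, (s < t)%N -> ~~ decodable f r s) (undecoded_before f r t).
Proof.
apply: (iffP forallP) => [H s st|H s]; last exact: H.
exact: (H (Ordinal st)).
Qed.

Lemma undecoded_beforeS f r t :
  undecoded_before f r t.+1 = undecoded_before f r t && ~~ decodable f r t.
Proof.
apply/undecoded_beforeP/andP => [H|[/undecoded_beforeP H Ht] s].
  by split; [apply/undecoded_beforeP => s /ltnW; exact: H|exact: H].
by rewrite ltnS leq_eqVlt => /predU1P[->//|]; exact: H.
Qed.

(** The sink [r] itself witnesses that [v] is active, also at time [t], since activity only looks at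
    earlier times. *)
Lemma arcnc_undecoded x r t s v : undecoded_before (arcnc x) r t ->
  (s <= t)%N -> v \in val r -> arcnc x s v = x s v.
Proof.
move=> /undecoded_beforeP und st vr; rewrite arcncE; case: ifPn => // /negP[].
apply/existsP; exists r; rewrite vr; apply/undecoded_beforeP => u us.
by apply: und; exact: leq_trans st.
Qed.

(* Until a sink decodes, its parents are active, so it sees the raw draws. *)
Lemma undecoded_before_arcnc x r t :
  undecoded_before (arcnc x) r t = undecoded_before x r t.
Proof.
elim: t => [|t IH]; first by apply/undecoded_beforeP/undecoded_beforeP.
rewrite !undecoded_beforeS -IH; case: (boolP (undecoded_before _ r t)) => //=.
move=> und; congr (~~ _); apply: eq_decodable => s v.
exact: arcnc_undecoded und.
Qed.

(** A time with values in the naturals or infinity counts the [t] with [T > t], and [T > t] means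
    undecoded before [t.+1]. *)
Lemma first_decoding_timeE (R : realType) f r :
  first_decoding_time R f r =
  (\sum_(0 <= t <oo) (undecoded_before f r t.+1)%:R%:E)%E.
Proof.
have nn k : (0 <= k)%N -> true ->
  (0 <= ((undecoded_before f r k.+1)%:R : R)%:E)%E by rewrite lee_fin.
rewrite /first_decoding_time; case: pselect => [h|h].
  case: ex_minnP => T decT Tmin.
  rewrite (nneseries_split 0 T); last by move=> k _; rewrite lee_fin.
  rewrite eseries0 => [|k Tk _]; last first.
    have -> : undecoded_before f r k.+1 = false; last by [].
    by apply/undecoded_beforeP => /(_ T); rewrite decT ltnS => /(_ Tk).
  rewrite adde0 add0n (eq_big_nat _ _ (F2 := fun=> 1%E)) => [|t /= tT].
    by rewrite sumEFin sumr_const_nat subn0.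
  suff -> : undecoded_before f r t.+1 by [].
  apply/undecoded_beforeP => s st; apply/negP => /Tmin.
  by rewrite leqNgt (leq_ltn_trans _ tT).
(* Without decoding every term is 1, so the partial sums exceed any real. *)
apply/esym/eq_infty => x.
have [N xN] : exists N : nat, x <= N%:R.
  exists (Num.bound `|x|); apply: le_trans (ler_norm x) (ltW _).
  exact: archi_boundP.
apply: le_trans (nneseries_lim_ge N nn).
rewrite (eq_big_nat _ _ (F2 := fun=> 1%E)) => [|t /= tT].
  by rewrite sumEFin sumr_const_nat subn0 lee_fin.
suff -> : undecoded_before f r t.+1 by [].
by apply/undecoded_beforeP => s st; apply/negP => ds; apply: h; exists s.
Qed.

End RunOfArcnc.

(** * Expected decoding times of one sink and on average *)

Section DecodingTime.
Variables (R : realType) (d : measure_display) (Omega : measurableType d).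
Variables (P : probability Omega R) (n m : nat) (F : finFieldType).
Variable X : nat * 'I_n * 'I_m -> Omega -> F.
Hypothesis iidX : iid_uniform P X.

Definition observed (r : sink n m) (t : nat) (w : Omega) :
    'M['rV[F]_t.+1]_m :=
  \matrix_(i, j) \row_k X (val k, parent r j, i) w.

(** The transfer matrix at time [s] is the truncation to [s.+1] coefficients of the one at time
    [t]. *)
Lemma undecoded_before_stuck r t w :
  undecoded_before (draws X w) r t.+1 = stuck (observed r t w).
Proof.
apply: eq_forallb => s; rewrite negbK; congr (\det _ == 0).
apply/matrixP => i j; rewrite !mxE; apply/polyP => k.
rewrite coef_poly coef_take_poly; case: ifP => // ks.
have kt : (k < t.+1)%N := leq_trans ks (ltn_ord s).
by rewrite -[k]/(val (Ordinal kt)) coef_rVpoly_ord !mxE.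
Qed.

Let coordinate (r : sink n m) t (j : 'I_t.+1 * 'I_m * 'I_m) :=
  (val j.1.1, parent r j.1.2, j.2).

Let coordinate_inj r t : injective (@coordinate r t).
Proof.
by move=> [[k j] i] [[k' j'] i'] [/= /val_inj-> /parent_inj-> ->].
Qed.

Let observedP r t w (A : 'M['rV[F]_t.+1]_m) :
  observed r t w = A <->
  forall j, X (coordinate r j) w = A j.2 j.1.2 0 j.1.1.
Proof.
split=> [<- j|XA]; first by rewrite !mxE.
apply/matrixP => i j; rewrite mxE; apply/rowP => k; rewrite mxE.
exact: (XA (k, j, i)).
Qed.

Let measurable_undecoded r t :
  measurable [set w | undecoded_before (draws X w) r t.+1].
Proof.
under eq_set do rewrite undecoded_before_stuck.
exact: (measurable_event iidX (@observedP r t)).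
Qed.

(** The value involves neither [r] nor [n]: this makes all sinks alike and the expectation
    independent of [n]. *)
Lemma prob_undecoded r t :
  P [set w | undecoded_before (draws X w) r t.+1] = (stuck_prob R F m t)%:E.
Proof.
under eq_set do rewrite undecoded_before_stuck.
rewrite (prob_event iidX (@coordinate_inj r t) (@observedP r t)).
by rewrite !card_prod !card_ord /stuck_prob mulnA.
Qed.

Lemma T_sinkE r w :
  T_sink R X r w =
  (\sum_(0 <= t <oo)
     (\1_[set w | undecoded_before (draws X w) r t.+1] w)%:E)%E.
Proof.
rewrite /T_sink first_decoding_timeE; apply: eq_eseriesr => t _.
by rewrite undecoded_before_arcnc indicE mem_setE.
Qed.

Lemma T_sink_ge0 r w : (0 <= T_sink R X r w)%E.
Proof. by rewrite T_sinkE; apply: nneseries_ge0 => t *; rewrite lee_fin. Qed.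

Lemma measurable_T_sink r : measurable_fun setT (T_sink R X r).
Proof.
rewrite (_ : T_sink R X r = fun w => \sum_(0 <= t <oo | t \in predT)
  (\1_[set w | undecoded_before (draws X w) r t.+1] w)%:E)%E.
  apply: ge0_emeasurable_sum => [t w *|t _]; first by rewrite lee_fin.
  by apply/measurable_EFinP; exact: measurable_indic.
by apply/funext => w; rewrite T_sinkE.
Qed.

Lemma expect_T_sink r :
  expect P (T_sink R X r) = (\sum_(0 <= t <oo) (stuck_prob R F m t)%:E)%E.
Proof.
rewrite /expect; under eq_integral do rewrite T_sinkE.
rewrite integral_nneseries // => [|t].
  apply: eq_eseriesr => t _.
  by rewrite integral_indic // setIT; exact: prob_undecoded.
by apply/measurable_EFinP; exact: measurable_indic.
Qed.

(** Only linearity of the integral is used, as sinks sharing parents are dependent; [m <= n] makes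
    the number of sinks nonzero. *)
Lemma expect_T_avg : (m <= n)%N ->
  expect P (T_avg R X) = (\sum_(0 <= t <oo) (stuck_prob R F m t)%:E)%E.
Proof.
move=> mn; rewrite /expect /T_avg ge0_integralZl_EFin //=; last 2 first.
- by move=> w _; apply: sume_ge0 => r _; exact: T_sink_ge0.
- by apply: emeasurable_sum => r; exact: measurable_T_sink.
rewrite ge0_integral_sum //; last 2 first.
- by move=> r; exact: measurable_T_sink.
- by move=> r w _; exact: T_sink_ge0.
rewrite (eq_bigr _ (fun r _ => expect_T_sink r)).
set S := (\sum_(0 <= t <oo) _)%E.
have card_sink : #|{: sink n m}| = 'C(n, m).
  rewrite card_sig -[in RHS](card_ord n) -card_draws.
  by apply: eq_card => A; rewrite !inE.
have -> : (\sum_(r : sink n m) S = 'C(n, m)%:R%:E * S)%E.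
  rewrite big_const card_sink.
  elim: 'C(n, m) => [|N IH]; first by rewrite mul0e.
  by rewrite iterS IH -nat1r EFinD ge0_muleDl ?lee_fin // mul1e.
by rewrite muleA -EFinM mulVf ?mul1e // pnatr_eq0 -lt0n bin_gt0 //.
Qed.

End DecodingTime.

(** * The numerical example and the bounds on the expected average time *)

Lemma ET_UB22 (R : realType) : ET_UB R 2 2 = 5%:R / 3%:R.
Proof.
rewrite /ET_UB big_ltn // big_nat1 !subn1 /= bin1 binn.
rewrite expr0 expr1 expr1 mul1r mulr1.
by field.
Qed.

Theorem mainTheorem3 (R : realType) (m : nat) (hm : (0 < m)%N) :
  [/\ forall (F : finFieldType) (n : nat), (m <= n)%N ->
      forall (d : measure_display) (Omega : measurableType d)
        (P : probability Omega R)
        (X : (nat * 'I_n * 'I_m)%type -> Omega -> F), iid_uniform P X ->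
      (forall r : sink n m, expect P (T_avg R X) = expect P (T_sink R X r)) /\
      ((1 < m)%N ->
       ((ET_LB R m #|F|)%:E < expect P (T_avg R X))%E /\
       (expect P (T_avg R X) < (ET_UB R m #|F|)%:E)%E),
      ET_UB R 2 2 = 5%:R / 3%:R,
      forall (F : finFieldType) (n n' : nat), (m <= n)%N -> (m <= n')%N ->
      forall (d d' : measure_display)
        (Omega : measurableType d) (Omega' : measurableType d')
        (P : probability Omega R) (P' : probability Omega' R)
        (X : (nat * 'I_n * 'I_m)%type -> Omega -> F)
        (X' : (nat * 'I_n' * 'I_m)%type -> Omega' -> F),
      iid_uniform P X -> iid_uniform P' X' ->
      expect P (T_avg R X) = expect P' (T_avg R X')
    & ET_UB R m q @[q --> \oo] --> (0 : R)].
Proof.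
split; [|exact: ET_UB22| |exact: cvg_ET_UB].
  move=> F n mn d Omega P X iidX; split=> [r|m1].
    by rewrite (expect_T_avg iidX mn) (expect_T_sink iidX).
  by rewrite (expect_T_avg iidX mn); exact: sum_stuck_prob_bounds.
move=> F n n' mn mn' d d' Omega Omega' P P' X X' iidX iidX'.
by rewrite (expect_T_avg iidX mn) (expect_T_avg iidX' mn').
Qed.
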